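(* Let $\mathcal{P}$ be a connected-hereditary or rooted-hereditary graph property. Let $G$ be a graph with $n$ vertices and let $v_r$ be a vertex of $G$ such that $G[\{v_r\}]\in\mathcal{P}$. Let $K=|\mathcal{P}^m(G;v_r)|$. Then the algorithm GenWithVertex (described in the context) on input $(G,v_r)$ returns exactly $\mathcal{P}^m(G;v_r)$, and it runs in time $O\big(n^2 K^2\, r'_{\mathcal{P}}(n,K)\,(s_{\mathcal{P}}(n)+n)\big)$.
   Context: A graph is a triple $G=(V,E,r)$ with $V$ a finite set of vertices, $E\subseteq V\times V$ a set of (directed) edges, and a root $r\in V\cup\{\bot\}$. $G$ is rooted if $r\neq\bot$ and every vertex is reachable from $r$ by a directed path; $G$ is connected if its underlying undirected graph is connected. $H$ is an induced subgraph of $G$, written $H\subseteq_{\mathrm{IS}} G$, if $H$ is obtained from $G$ by deleting some vertices (and incident edges), and the root of $H$ equals the root of $G$ if that root is still a vertex of $H$, and is $\bot$ otherwise; $H\subset_{\mathrm{IS}}G$ means additionally $H\neq G$. For $U\subseteq V$, $G[U]$ is the induced subgraph with vertex set $U$; $G[H,v]=G[V(H)\cup\{v\}]$ and $G[H,H']=G[V(H)\cup V(H')]$; $G-v=G[V\setminus\{v\}]$. A graph property is a nonempty set $\mathcal{P}$ of graphs, with membership decidable in polynomial time; $s_{\mathcal{P}}(n)$ is the time to test membership for a graph with $n$ vertices. $\mathcal{P}$ is connected-hereditary if all its graphs are connected and every connected induced subgraph of a graph in $\mathcal{P}$ is in $\mathcal{P}$; it is rooted-hereditary if all its graphs are rooted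 and every rooted induced subgraph of a graph in $\mathcal{P}$ is in $\mathcal{P}$. A $\mathcal{P}$-subgraph of $G$ is an $H\subseteq_{\mathrm{IS}}G$ with $H\in\mathcal{P}$; it is maximal if no $\mathcal{P}$-subgraph $H'$ of $G$ has $H\subset_{\mathrm{IS}}H'$; $\mathcal{P}^m(G;v)$ is the set of maximal $\mathcal{P}$-subgraphs of $G$ containing vertex $v$. $G$ almost satisfies $\mathcal{P}$ if $G-v\in\mathcal{P}$ for some vertex $v$. Fix a procedure $\mathrm{R}'$ which, given a graph $G'$ almost satisfying $\mathcal{P}$ and a vertex $v$, returns $\mathcal{P}^m(G';v)$; $r'_{\mathcal{P}}(n,K)$ is its running time on inputs with $n$ vertices and output of $K$ graphs. For $H\subseteq_{\mathrm{IS}}G$, $N_{\mathcal{P}}(H,G)$ is: if $\mathcal{P}$ is connected-hereditary, the set of vertices $v\notin V(H)$ such that $(v,v')$ or $(v',v)$ is an edge of $G$ for some $v'\in V(H)$; if $\mathcal{P}$ is rooted-hereditary, the set of $v\notin V(H)$ such that $(v',v)$ is an edge of $G$ for some $v'\in V(H)$. Each graph $H$ handled by the algorithm carries a vertex set $\overline{V}(H)$. PushAppropriate$(H)$: if $N_{\mathcal{P}}(H,G)\not\subseteq\overline{V}(H)$, push $H$ onto Stack$_1$, otherwise push $H$ onto Stack$_2$. Algorithm GenWithVertex$(G,v_r)$: set $\overline{V}(G[\{v_r\}])=\emptyset$, Stack$_1$ and Stack$_2$ empty, and PushAppropriate$(G[\{v_r\}])$. While Stack$_1$ is nonempty: pop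 $H$ from Stack$_1$ and choose $v\in N_{\mathcal{P}}(H,G)\setminus\overline{V}(H)$. If $G[H,v]\in\mathcal{P}$: set $\overline{V}(G[H,v])=\emptyset$ and PushAppropriate$(G[H,v])$. Otherwise: add $v$ to $\overline{V}(H)$; for each $G'\in\mathrm{R}'(G[H,v],v_r)\setminus\{H\}$: set $\overline{V}(G')=\emptyset$ and inserted $=$ false; for each $H'$ in Stack$_1$ with $G[G',H']\in\mathcal{P}$, let $G_{\mathrm{new}}=G[G',H']$, set $\overline{V}(G_{\mathrm{new}})=\emptyset$, remove $H'$ from Stack$_1$, PushAppropriate$(G_{\mathrm{new}})$, and set inserted $=$ true; if some $H'$ in Stack$_2$ has $V(G')\subseteq V(H')$, set inserted $=$ true; if inserted is false, PushAppropriate$(G')$. After processing all such $G'$, PushAppropriate$(H)$. When Stack$_1$ is empty, return the contents of Stack$_2$. *)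

(* Defs.v *)
(* MathComp, with finmap for finite sets over an arbitrary choiceType. *)
From HB Require Import structures.
From mathcomp Require Import all_boot finmap.

Set Implicit Arguments.
Unset Strict Implicit.
Unset Printing Implicit Defensive.

Local Open Scope fset_scope.
Local Open Scope nat_scope.

Section Graphs.
Variable T : choiceType.

Definition graph_wf (D : {fset T} * {fset T * T} * option T) : bool :=
  (D.1.2 `<=` D.1.1 `*` D.1.1) &&
  (if D.2 is Some r then r \in D.1.1 else true).

(* The triple (V, E, r); the root value None is the symbol bottom. *)
Record graph := Graph {
  graph_data : {fset T} * {fset T * T} * option T;
  graph_wfP : graph_wf graph_data }.

HB.instance Definition _ := [isSub for graph_data].
HB.instance Definition _ := [Choice of graph by <:].

Definition vertices (G : graph) : {fset T} := (graph_data G).1.1.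
Definition edges (G : graph) : {fset T * T} := (graph_data G).1.2.
Definition groot (G : graph) : option T := (graph_data G).2.

Definition edge (G : graph) : rel T := fun u v => (u, v) \in edges G.
Definition uedge (G : graph) : rel T := fun u v => edge G u v || edge G v u.

Definition joined (e : rel T) (u v : T) : Prop :=
  exists2 p : seq T, path e u p & last u p = v.

Definition rooted (G : graph) : Prop :=
  exists2 r : T, groot G = Some r &
    forall v, v \in vertices G -> joined (edge G) r v.

(* The graph without vertices is connected under this definition. *)
Definition connected (G : graph) : Prop :=
  forall u v, u \in vertices G -> v \in vertices G -> joined (uedge G) u v.

Definition induced_data (G : graph) (U : {fset T}) :
    {fset T} * {fset T * T} * option T :=
  (vertices G `&` U,
   [fset e in edges G | (e.1 \in U) && (e.2 \in U)],
   if groot G is Some r then if r \in U then Some r else None else None).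

Lemma induced_wf (G : graph) (U : {fset T}) : graph_wf (induced_data G U).
Proof.
case: G => [[[V E] r]] /= wfG; move/andP: (wfG) => /= [/fsubsetP EV rV].
rewrite /graph_wf /induced_data /=; apply/andP; split.
  apply/fsubsetP => e; rewrite !inE /= => /andP[/EV + /andP[-> ->]].
  by rewrite in_fsetM => /andP[-> ->].
case: r wfG rV => [r|] //= wfG rV; rewrite /groot /=.
by case: ifP => // rU; rewrite !inE rU andbT.
Qed.

(* G[U]; vertices of U outside G are ignored. *)
Definition induced (G : graph) (U : {fset T}) : graph :=
  Graph (induced_wf G U).

Definition add_vertex (G H : graph) (v : T) : graph :=
  induced G (v |` vertices H).
Definition join (G H H' : graph) : graph :=
  induced G (vertices H `|` vertices H').
Definition del_vertex (G : graph) (v : T) : graph :=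
  induced G (vertices G `\ v).

Definition isub (H G : graph) : bool :=
  (vertices H `<=` vertices G) && (H == induced G (vertices H)).
Definition psub (H G : graph) : bool := isub H G && (H != G).

Definition isubs (G : graph) : {fset graph} :=
  [fset induced G U | U in fpowerset (vertices G)].

(* prop_time H is the time of the membership test on H; every polynomial in n
   is below n ^ d + d for some d. *)
Record graph_property := GraphProperty {
  prop_mem :> pred graph;
  prop_time : graph -> nat;
  prop_nonempty : exists H, prop_mem H;
  prop_poly : exists d, forall H,
    prop_time H <= #|` vertices H| ^ d + d }.

(* A property is handled either as a connected-hereditary or as a
   rooted-hereditary one; this also selects the notion of neighbour. *)
Inductive kind := Connected | Rooted.

Definition shape (k : kind) : graph -> Prop :=
  match k with Connected => connected | Rooted => rooted end.

Definition hereditary (k : kind) (P : pred graph) : Prop :=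
  (forall H, P H -> shape k H) /\
  (forall H H', P H -> isub H' H -> shape k H' -> P H').

Definition subgraph_of (P : pred graph) (G H : graph) : bool :=
  isub H G && P H.

Definition maximal_subgraph (P : pred graph) (G H : graph) : bool :=
  subgraph_of P G H &&
  all (fun H' => ~~ (subgraph_of P G H' && psub H H')) (isubs G).

(* P^m(G; v) *)
Definition maximal_with (P : pred graph) (G : graph) (v : T) : {fset graph} :=
  [fset H in isubs G | maximal_subgraph P G H & v \in vertices H].

Definition almost_satisfies (P : pred graph) (G : graph) : Prop :=
  exists2 v, v \in vertices G & P (del_vertex G v).

(* The procedure R'. Its running time covers at least the time needed to write
   down the vertices of the graphs that it returns. *)
Record restricted_solver (P : pred graph) := RestrictedSolver {
  solve :> graph -> T -> seq graph;
  solve_time : graph -> T -> nat;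
  solveP : forall G v, almost_satisfies P G -> v \in vertices G ->
    perm_eq (solve G v) (maximal_with P G v);
  solve_output : forall G v, almost_satisfies P G -> v \in vertices G ->
    \sum_(H <- solve G v) #|` vertices H| <= solve_time G v }.

(* s_P(n): worst-case time on graphs with at most n vertices. *)
Definition test_time_bound (P : graph_property) (s : nat -> nat) : Prop :=
  forall n H, #|` vertices H| <= n -> prop_time P H <= s n.

(* r'_P(n, K): worst-case time on graphs with at most n vertices and with an
   output of at most K graphs; any run takes at least one step. *)
Definition solve_time_bound (P : pred graph) (R : restricted_solver P)
    (r' : nat -> nat -> nat) : Prop :=
  forall n K, 0 < r' n K /\
    forall H v, almost_satisfies P H -> v \in vertices H ->
      #|` vertices H| <= n -> size (R H v) <= K ->
      solve_time R H v <= r' n K.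

(* N_P(H, G) *)
Definition neighbours (k : kind) (H G : graph) : {fset T} :=
  let e := match k with Connected => uedge G | Rooted => edge G end in
  [fset v in vertices G |
    (v \notin vertices H) && has (fun v' => e v' v) (vertices H)].

End Graphs.

(* Nondeterministic computations with a cost: m x t says that some run of m
   yields x in time t. *)
Definition timed (A : Type) := A -> nat -> Prop.

Definition ret A (x : A) : timed A := fun y t => y = x /\ t = 0.
Definition tick (d : nat) : timed unit := fun _ t => t = d.
Definition pick_in A (S : pred A) : timed A := fun x t => S x /\ t = 0.
Definition bind A B (m : timed A) (f : A -> timed B) : timed B :=
  fun y t => exists x t1 t2, [/\ m x t1, f x y t2 & t = t1 + t2].

Notation "'let!' x := m 'in' f" := (bind m (fun x => f))
  (at level 200, x name, f at level 200).
Notation "'tick!' d 'in' f" := (bind (tick d) (fun _ => f))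
  (at level 200, f at level 200).

Fixpoint foreach A B (l : seq A) (body : A -> B -> timed B) (b : B) : timed B :=
  if l is x :: l' then let! b' := body x b in foreach l' body b' else ret b.

(* Total correctness of [while guard do body], started at time t: no run gets
   stuck, no run is infinite, and each run ends in a state and at a time
   related by Q. *)
Inductive while_ensures A (guard : pred A) (body : A -> timed A)
    (Q : A -> nat -> Prop) : A -> nat -> Prop :=
| while_exit a t : ~~ guard a -> Q a t -> while_ensures guard body Q a t
| while_loop a t : guard a ->
    (exists a' d, body a a' d) ->
    (forall a' d, body a a' d -> while_ensures guard body Q a' (t + d)) ->
    while_ensures guard body Q a t.

(* GenWithVertex(G, v_r). A stack entry is a pair (H, Vbar(H)); a state is the
   pair (Stack_1, Stack_2), each with its top at the head.

   Cost model. Besides the charges for the membership tests and for R', an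
   operation on vertex sets of G (pop, choice, union, inclusion, comparison,
   push) costs c * n, where n = |V(G)| and c is a machine constant. An induced
   subgraph of G is represented by its vertex set, and its neighbourhood
   N_P(H, G) is kept with it: for G[H, v] and G[G', H'] it comes from the
   known neighbourhoods by set operations within the same c * n, while for a
   graph G' returned by R' it is computed from the adjacency rows of the
   vertices of G', at a cost of c * n * |V(G')|. *)
Section GenWithVertex.
Variables (T : choiceType) (c : nat) (k : kind) (P : graph_property T).
Variables (R : restricted_solver P) (G : graph T) (vr : T).

Let n := #|` vertices G|.

Definition entry : Type := (graph T * {fset T})%type.
Definition state : Type := (seq entry * seq entry)%type.

Definition push_appropriate (e : entry) (st : state) : timed state :=
  tick! c * n in
  ret (if neighbours k e.1 G `<=` e.2 then (st.1, e :: st.2)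
       else (e :: st.1, st.2)).

(* One turn of the loop over the H' in Stack_1; the boolean is the flag
   inserted. *)
Definition absorb (G' : graph T) (e : entry) (x : state * bool) :
    timed (state * bool) :=
  let Gnew := join G G' e.1 in
  tick! c * n + prop_time P Gnew in
  if P Gnew then
    let! st := push_appropriate (Gnew, fset0) (rem e x.1.1, x.1.2) in
    ret (st, true)
  else ret x.

(* The loop over Stack_1 visits, in any order, the entries present when the
   loop starts, and not the graphs that the loop itself pushes. *)
Definition insert (G' : graph T) (st : state) : timed state :=
  tick! c * n * #|` vertices G'| in
  let! order := pick_in (perm_eq st.1) in
  let! x := foreach order (absorb G') (st, false) in
  tick! c * n * size x.1.2 in
  if x.2 || has (fun e => vertices G' `<=` vertices e.1) x.1.2 then ret x.1
  else push_appropriate (G', fset0) x.1.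

Definition iteration (st : state) : timed state :=
  if st is ((H, Vbar) :: stack1, stack2) then
    tick! c * n in
    let! v := pick_in (mem (neighbours k H G `\` Vbar)) in
    let Hv := add_vertex G H v in
    tick! prop_time P Hv in
    if P Hv then push_appropriate (Hv, fset0) (stack1, stack2)
    else
      let out := R Hv vr in
      tick! solve_time R Hv vr in
      tick! c * n * size out in
      let! st' := foreach [seq G' <- out | G' != H] insert (stack1, stack2) in
      push_appropriate (H, v |` Vbar) st'
  else ret st.

(* Every run of the algorithm terminates, and the returned list of graphs and
   the running time are related by Q. *)
Definition gen_with_vertex_ensures (Q : seq (graph T) -> nat -> Prop) : Prop :=
  forall st t,
    push_appropriate (induced G [fset vr], fset0) ([::], [::]) st t ->
    while_ensures (fun st : state => ~~ nilp st.1) iteration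
      (fun st t => Q [seq e.1 | e <- st.2] t) st t.

End GenWithVertex.

(* Main.v *)
Require Import Defs.
From HB Require Import structures.
From mathcomp Require Import all_boot finmap.
From mathcomp Require Import zify.

Set Implicit Arguments.
Unset Strict Implicit.
Unset Printing Implicit Defensive.

Local Open Scope fset_scope.
Local Open Scope nat_scope.

(** Call a vertex set containing v_r admissible if it induces a P-subgraph. When
    A is contained in an admissible B, A grows to B inside the admissible sets by
    adding one neighbour at a time, and a union of admissible sets is admissible
    as soon as it lies in one. Therefore the graphs handled by the algorithm,
    no two of which have an admissible union, extend to distinct maximal
    P-subgraphs, so there are at most K of them, and a graph whose neighbours are
    all in Vbar is maximal. No maximal M is missed: a connected (rooted) part
    of M lying in an entry H of Stack_2 grows by a vertex v of M, which is in H or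
    in Vbar(H), and in the latter case the enlarged part lies in a graph that R'
    returned for G[H, v], hence in an entry.
    Stack_1 is last-in first-out and H is pushed back last, so each graph reaches
    Stack_2 within n^2 iterations of coming to the top: there are at most n^2 K
    iterations, each costing O(K r' (s + n)). *)

(** * Induced subgraphs as vertex sets *)

Section Induced.
Variable T : choiceType.
Implicit Types (G H : graph T) (U W D : {fset T}) (u v : T).

Lemma graph_eqP G H :
  vertices G = vertices H -> edges G = edges H -> groot G = groot H -> G = H.
Proof.
move=> eV eE eR; apply: val_inj; move: eV eE eR.
by case: G => [[[? ?] ?] ?]; case: H => [[[? ?] ?] ?] /=;
  rewrite /vertices /edges /groot /= => -> -> ->.
Qed.

Lemma vertices_induced G U : vertices (induced G U) = vertices G `&` U.
Proof. by []. Qed.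

Lemma vertices_induced_sub G U :
  U `<=` vertices G -> vertices (induced G U) = U.
Proof. by move=> sUG; rewrite vertices_induced; apply/fsetIidPr. Qed.

Lemma edge_induced G U u v :
  edge (induced G U) u v = [&& edge G u v, u \in U & v \in U].
Proof. by rewrite /edge /edges /= !inE. Qed.

Lemma uedge_induced G U u v :
  uedge (induced G U) u v = [&& uedge G u v, u \in U & v \in U].
Proof.
by rewrite /uedge !edge_induced; case: (u \in U); case: (v \in U);
  rewrite ?andbF ?andbT.
Qed.

Lemma groot_induced G U :
  groot (induced G U) =
  if groot G is Some r then if r \in U then Some r else None else None.
Proof. by []. Qed.

Lemma induced_vertices G : induced G (vertices G) = G.
Proof.
have /andP[/fsubsetP sE sr] := graph_wfP G.
apply: graph_eqP.
- by rewrite vertices_induced fsetIid.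
- apply/fsetP => e; rewrite /edges /= !inE.
  case eG: (e \in _) => //=; move: (sE _ eG).
  by rewrite in_fsetM => /andP[-> ->].
- rewrite groot_induced; move: sr; rewrite /groot /vertices.
  by case: (graph_data G).2 => // r ->.
Qed.

Lemma induced_induced G U W :
  W `<=` U -> induced (induced G U) W = induced G W.
Proof.
move=> sWU; have /fsubsetP sWU' := sWU; apply: graph_eqP.
- by rewrite !vertices_induced -fsetIA; congr (_ `&` _); apply/fsetIidPr.
- apply/fsetP => e; rewrite /edges /= !inE.
  case e1: (e.1 \in W); case e2: (e.2 \in W); rewrite ?andbF //=.
  by rewrite (sWU' _ e1) (sWU' _ e2) !andbT.
- rewrite !groot_induced; case: (groot G) => // r.
  case rW: (r \in W); first by rewrite (sWU' _ rW) rW.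
  by case: ifP; rewrite ?rW.
Qed.

Lemma isub_induced G U W :
  U `<=` vertices G -> W `<=` vertices G ->
  isub (induced G U) (induced G W) = (U `<=` W).
Proof.
move=> sU sW; rewrite /isub !vertices_induced_sub //.
by case sUW: (U `<=` W); rewrite //= induced_induced ?eqxx.
Qed.

Lemma isub_induced_trans G D H : D `<=` vertices G ->
  isub H (induced G D) ->
  H = induced G (vertices H) /\ vertices H `<=` D.
Proof.
move=> sD /andP[sH /eqP eH]; rewrite vertices_induced_sub // in sH.
by split=> //; rewrite {1}eH induced_induced.
Qed.

(** An induced subgraph is determined by its vertex set, so maximality inside [induced G D] becomes
    maximality among subsets of [D], with all graphs induced directly from [G]. *)
Lemma mem_maximal_with (P : pred (graph T)) G D H v : D `<=` vertices G ->
  reflect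
    [/\ vertices H `<=` D, H = induced G (vertices H), P H, v \in vertices H &
      forall W, W `<=` D -> P (induced G W) -> vertices H `<=` W ->
        W = vertices H]
    (H \in maximal_with P (induced G D) v).
Proof.
move=> sD; rewrite !inE /=; apply: (iffP idP).
- move=> /and3P[_ /andP[/andP[iH PH] /allP mH] vH].
  have [eH sH] := isub_induced_trans sD iH.
  have sHG : vertices H `<=` vertices G := fsubset_trans sH sD.
  split=> // W sW PW sHW; have sWG := fsubset_trans sW sD.
  have := mH (induced G W).
  have -> : induced G W \in isubs (induced G D).
    apply/imfsetP; exists W => /=.
      by rewrite fpowersetE vertices_induced_sub.
    by rewrite induced_induced.
  move/(_ isT); rewrite /subgraph_of /psub isub_induced // sW PW /=.
  rewrite {1 2}eH isub_induced // sHW /= negbK => /eqP.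
  by move=> /(congr1 (@vertices T)); rewrite !vertices_induced_sub.
- case=> sH eH PH vH mH; have sHG := fsubset_trans sH sD.
  apply/and3P; split=> //.
    apply/imfsetP; exists (vertices H) => /=.
      by rewrite fpowersetE vertices_induced_sub.
    by rewrite induced_induced.
  apply/andP; split.
    by rewrite /subgraph_of PH andbT {1}eH isub_induced.
  apply/allP => H' _; apply/negP => /andP[/andP[iH' PH'] /andP[iHH' nHH']].
  have [eH' sH'] := isub_induced_trans sD iH'.
  have sH'G := fsubset_trans sH' sD.
  case/negP: nHH'; apply/eqP; rewrite eH eH'; congr induced.
  apply/esym/mH => //; first by rewrite -eH'.
  by have /andP[] := iHH'.
Qed.

End Induced.

(** * Admissible sets under a hereditary property *)

Section Hereditary.
Variables (T : choiceType) (k : kind) (P : pred (graph T)).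
Variables (G : graph T) (vr : T).
Hypothesis herP : hereditary k P.
Hypothesis vrG : vr \in vertices G.
Hypothesis Pvr : P (induced G [fset vr]).
Implicit Types (U W D : {fset T}) (u v : T).

Definition arc : rel T :=
  match k with Connected => uedge G | Rooted => edge G end.

Definition arc_in U : rel T := fun u v => [&& arc u v, u \in U & v \in U].

Definition spanned U := forall v, v \in U -> joined (arc_in U) vr v.

Lemma joined_sub (e e' : rel T) u v :
  subrel e e' -> joined e u v -> joined e' u v.
Proof. by move=> see' [p pp lp]; exists p => //; apply: sub_path pp. Qed.

Lemma arc_in_sub U W : U `<=` W -> subrel (arc_in U) (arc_in W).
Proof.
by move=> /fsubsetP sUW u v /and3P[a uU vU]; rewrite /arc_in a !sUW.
Qed.

Lemma joined_trans (e : rel T) u v w :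
  joined e u v -> joined e v w -> joined e u w.
Proof.
move=> [p pp lp] [q pq lq]; exists (p ++ q); rewrite ?last_cat ?lp //.
by rewrite cat_path pp lp.
Qed.

Lemma joined_sym (e : rel T) u v : symmetric e -> joined e u v -> joined e v u.
Proof.
move=> se [p pp <-]; exists (rev (belast u p)).
  by rewrite rev_path; apply: sub_path pp => x y; rewrite /= se.
by case: p pp => //= x p _; rewrite rev_cons last_rcons.
Qed.

(** The graph induced on [vr] alone is rooted, and an induced subgraph can only inherit its root
    from [G]. *)
Lemma groot_rooted : k = Rooted -> groot G = Some vr.
Proof.
move=> ek; have := herP.1 _ Pvr; rewrite ek /= => -[r].
rewrite groot_induced; case: (groot G) => // r'.
by rewrite in_fset1; case: eqP => // -> _ _.
Qed.

(** Both shapes reduce to reachability from [vr]: arcs are symmetric in the connected case, so any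
    two vertices are joined through [vr]; in the rooted case [vr] is the root. *)
Lemma shapeP U : U `<=` vertices G -> vr \in U ->
  Defs.shape k (induced G U) <-> spanned U.
Proof.
move=> sU vU; rewrite /Defs.shape /spanned /arc_in /arc.
case ek: k => /=.
  rewrite /connected vertices_induced_sub //.
  have seq :
      uedge (induced G U) =2 (fun u v => [&& uedge G u v, u \in U & v \in U]).
    by move=> u v; rewrite uedge_induced.
  split=> [cU v vU'|cU u v uU vU'].
    by apply: joined_sub (cU _ _ vU vU') => x y; rewrite seq.
  apply: (@joined_sub (fun u v => [&& uedge G u v, u \in U & v \in U])).
    by move=> x y; rewrite seq.
  apply: (@joined_trans _ _ vr); last exact: cU.
  apply: joined_sym (cU _ uU) => x y.
  by rewrite /uedge orbC andbCA andbC -andbA [_ && (x \in U)]andbC.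
have seq :
    edge (induced G U) =2 (fun u v => [&& edge G u v, u \in U & v \in U]).
  by move=> u v; rewrite edge_induced.
rewrite /rooted groot_induced groot_rooted // vU vertices_induced_sub //.
split=> [[r [<-] cU] v vU'|cU].
  by apply: joined_sub (cU _ vU') => x y; rewrite seq.
exists vr => // v vU'.
by apply: joined_sub (cU _ vU') => x y; rewrite seq.
Qed.

(** These are the admissible sets. *)
Definition pset U := [&& U `<=` vertices G, vr \in U & P (induced G U)].

Lemma pset_spanned U : pset U -> spanned U.
Proof. by case/and3P => sU vU PU; apply/shapeP => //; apply: herP.1. Qed.

Lemma pset_sub U W : pset U -> W `<=` U -> vr \in W -> spanned W -> pset W.
Proof.
move=> /and3P[sU vU PU] sWU vW cW; have sW := fsubset_trans sWU sU.
apply/and3P; split=> //; apply: herP.2 PU _ _; first by rewrite isub_induced.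
exact/shapeP.
Qed.

Lemma spannedU U W : spanned U -> spanned W -> spanned (U `|` W).
Proof.
move=> cU cW v /fsetUP[/cU|/cW]; apply: joined_sub; apply: arc_in_sub.
  exact: fsubsetUl.
exact: fsubsetUr.
Qed.

Lemma spanned1U U u v : spanned U -> u \in U -> arc u v -> spanned (v |` U).
Proof.
move=> cU uU auv w /fset1UP[->|wU].
  apply: (@joined_trans _ _ u).
    exact: joined_sub (arc_in_sub (fsubsetU1 _ _)) (cU _ uU).
  by exists [:: v] => //=; rewrite /arc_in auv fset1U1 fset1Ur.
exact: joined_sub (arc_in_sub (fsubsetU1 _ _)) (cU _ wU).
Qed.

(** Both [U] and [W] are spanned from [vr], hence so is their union, and heredity applies.
    Contraposed: two sets without an admissible union stay so when one is enlarged. *)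
Lemma pset_sub_union U W W' : pset U -> pset W -> W `<=` W' ->
  pset (U `|` W') -> pset (U `|` W).
Proof.
move=> pU pW sWW' pUW; apply: pset_sub pUW _ _ _.
- exact: fsetUS.
- by case/and3P: pU => _ vU _; rewrite in_fsetU vU.
- by apply: spannedU; apply: pset_spanned.
Qed.

Lemma path_crossing (e : rel T) (W : {fset T}) u p : path e u p -> u \in W ->
  last u p \notin W -> exists x y, [/\ x \in W, y \notin W & e x y].
Proof.
elim: p u => [|y p IHp] u /=; first by move=> _ ->.
case/andP=> euy pp uW lW; case yW: (y \in W); first exact: IHp pp yW lW.
by exists u, y; rewrite yW.
Qed.

(** A path inside [U] from [vr] to a vertex outside [W] must leave [W]; the arc by which it leaves
    gives the new vertex. *)
Lemma pset_grow U W : pset U -> pset W -> W `<` U ->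
  exists v, [/\ v \in U, v \notin W, pset (v |` W) &
    exists2 u, u \in W & arc u v].
Proof.
move=> pU pW; rewrite fproperE => /andP[/fsubsetP sWU /fsubsetPn[v vU vW]].
have [p pp lp] := pset_spanned pU vU.
have vrW : vr \in W by case/and3P: pW.
have := path_crossing pp vrW; rewrite lp vW => /(_ isT).
case=> [x [y [xW yW /and3P[a xU yU]]]].
exists y; split=> //; last by exists x.
apply: pset_sub pU _ _ _.
- by rewrite fsubUset fsub1set yU; apply/fsubsetP.
- by rewrite in_fset1U vrW orbT.
- exact: spanned1U (pset_spanned pW) xW a.
Qed.

(** * Maximal sets and antichains *)

Definition maxset D U :=
  [/\ U `<=` D, pset U & forall W, W `<=` D -> pset W -> U `<=` W -> W = U].

Lemma maxset_extend D U : U `<=` D -> pset U ->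
  exists2 M, maxset D M & U `<=` M.
Proof.
have [m] := ubnP (#|` D| - #|` U|); elim: m U => // m IHm U ltm sU pU.
case big: (has (fun W => pset W && (U `<` W)) (fpowerset D)).
  case/hasP: big => W /=; rewrite fpowersetE => sW /andP[pW ltUW].
  have lUW := fproper_ltn_card ltUW; have lW := fsubset_leq_card sW.
  have [|||M mM sWM] := IHm W => //.
    exact: leq_trans (ltn_sub2l (leq_trans lUW lW) lUW) ltm.
  by exists M => //; apply: fsubset_trans (fproper_sub ltUW) sWM.
exists U => //; split=> // W sW pW sUW; apply/eqP; rewrite eq_sym.
move/negbT/hasPn/(_ W): big; rewrite fpowersetE => /(_ sW).
by rewrite pW fproperEneq sUW andbT negbK.
Qed.

(** The ambient set [D] is all of [vertices G] for the final output, and the vertex set of G[H, v]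
    for a call to R'. *)
Lemma maximal_withP D H : D `<=` vertices G ->
  reflect (H = induced G (vertices H) /\ maxset D (vertices H))
    (H \in maximal_with P (induced G D) vr).
Proof.
move=> sD; apply: (iffP (mem_maximal_with _ _ _ sD)).
  case=> sH eH PH vH mH; split=> //; split=> //.
    by rewrite /pset vH -eH PH (fsubset_trans sH sD).
  by move=> W sW /and3P[_ _ PW]; apply: mH.
case=> eH [sH /and3P[_ vH PH] mH]; rewrite eH.
rewrite vertices_induced_sub ?(fsubset_trans sH sD) //; split=> // W sW PW sHW.
by apply: mH => //; rewrite /pset PW (fsubset_trans sW sD) (fsubsetP sHW).
Qed.

(* Stronger than incomparability: no two members lie in a common P-subgraph. *)
Definition antichain (S : seq {fset T}) :=
  uniq S /\ {in S &, forall U W, pset (U `|` W) -> U = W}.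

Lemma antichain_perm S S' : perm_eq S S' -> antichain S -> antichain S'.
Proof.
move=> eS [uS aS]; split; first by rewrite -(perm_uniq eS).
by move=> U W; rewrite -!(perm_mem eS); apply: aS.
Qed.

Lemma antichain_cons U S : pset U ->
  antichain (U :: S) <-> antichain S /\ {in S, forall W, ~~ pset (U `|` W)}.
Proof.
move=> pU; split.
- case=> /= /andP[US uS] aS; split.
    split=> // V W VS WS; apply: aS; by rewrite inE ?VS ?WS orbT.
  move=> W WS; apply/negP => /aS eUW; case/negP: US.
  by rewrite eUW ?inE ?eqxx ?WS ?orbT.
- case=> -[uS aS] nS; split.
    rewrite /= uS andbT; apply/negP => /nS.
    by rewrite fsetUid pU.
  move=> V W; rewrite !inE => /orP[/eqP->|VS] /orP[/eqP->|WS] //.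
  + by move=> pUW; have := nS _ WS; rewrite pUW.
  + by rewrite fsetUC => pUW; have := nS _ VS; rewrite pUW.
  + exact: aS.
Qed.

(* Distinct members of an antichain have distinct maximal extensions. *)
Lemma antichain_size S : all pset S -> antichain S ->
  size S <= #|` maximal_with P G vr|.
Proof.
set Ms := maximal_with P G vr => /allP pS [uS aS].
(* The default [G] is never reached for [U] in [S]: by [maxset_extend] the search succeeds. *)
pose ext U := nth G Ms (find (fun H => U `<=` vertices H) Ms).
have extP U : U \in S -> ext U \in Ms /\ U `<=` vertices (ext U).
  move=> /pS pU; have sU : U `<=` vertices G by case/and3P: pU.
  have hU : has (fun H => U `<=` vertices H) Ms.
    have [M mM sUM] := maxset_extend sU pU; have [sM _ _] := mM.
    apply/hasP; exists (induced G M); rewrite ?vertices_induced_sub //.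
    rewrite /Ms -[G in maximal_with _ G]induced_vertices.
    by apply/maximal_withP; rewrite ?fsubset_refl // vertices_induced_sub.
  by split; [rewrite /ext mem_nth // -has_find | apply: (nth_find G hU)].
have ue : uniq [seq ext U | U <- S].
  rewrite map_inj_in_uniq // => U W US WS eUW.
  have [mU sU] := extP _ US; have [_ sW] := extP _ WS.
  (* [U] and [W] lie in the same maximal graph, so their union is admissible and the antichain
     identifies them. *)
  apply: aS => //; apply: pset_sub (_ : pset (vertices (ext U))) _ _ _.
  - move: mU; rewrite /Ms -[G in maximal_with _ G]induced_vertices.
    by case/(maximal_withP _ (fsubset_refl _)) => _ [].
  - by rewrite fsubUset sU eUW sW.
  - by case/and3P: (pS _ US) => _ vU _; rewrite in_fsetU vU.
  - by apply: spannedU; apply: pset_spanned; apply: pS.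
rewrite -(size_map ext); apply: uniq_leq_size ue _ => H /mapP[U US ->].
by case: (extP _ US).
Qed.

(** An admissible union would still lie in [D], so by maximality it would equal both members. *)
Lemma maxset_antichain D S : uniq S -> {in S, forall U, maxset D U} ->
  antichain S.
Proof.
move=> uS mS; split=> // U W /mS[sU pU mU] /mS[sW pW mW] pUW.
have sUW : U `|` W `<=` D by rewrite fsubUset sU.
by rewrite -[LHS](mU _ sUW pUW (fsubsetUl _ _)) (mW _ sUW pUW (fsubsetUr _ _)).
Qed.

Lemma in_neighbours (H : graph T) v :
  (v \in neighbours k H G) =
  [&& v \in vertices G, v \notin vertices H & has (arc^~ v) (vertices H)].
Proof. by rewrite /neighbours !inE. Qed.

(** * The invariant on entries and its consequences *)

Implicit Types (L M : seq (entry T)) (e f : entry T).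

Definition verts e := vertices e.1.

Definition covers L W := exists2 f, f \in L & W `<=` verts f.

(* The invariant of the algorithm on the list of all entries in play: those of
   both stacks, and the one popped last. By the third clause, everything that
   R' reports when v is added to Vbar(H) remains below some entry. *)
Definition consistent L :=
  [/\ {in L, forall e, e.1 = induced G (verts e) /\ pset (verts e)},
      antichain (map verts L) &
      {in L, forall e v W, v \in e.2 -> W `<=` v |` verts e -> pset W ->
        covers L W}].

Lemma covers_sub L W W' : W `<=` W' -> covers L W' -> covers L W.
Proof. by move=> sW [f fL sf]; exists f => //; apply: fsubset_trans sf. Qed.

Lemma covers_perm L M W : perm_eq L M -> covers L W -> covers M W.
Proof. by move=> eLM [f fL sf]; exists f => //; rewrite -(perm_mem eLM). Qed.

Lemma covers_cons e L W : covers L W -> covers (e :: L) W.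
Proof. by case=> f fL sf; exists f => //; rewrite inE fL orbT. Qed.

Lemma consistent_perm L M : perm_eq L M -> consistent L -> consistent M.
Proof.
move=> eLM [gL aL vL]; split.
- by move=> e; rewrite -(perm_mem eLM); apply: gL.
- by apply: antichain_perm aL; apply: perm_map.
- move=> e; rewrite -(perm_mem eLM) => eL v W vW sW pW.
  exact: covers_perm eLM (vL _ eL _ _ vW sW pW).
Qed.

Lemma consistent_size L : consistent L -> size L <= #|` maximal_with P G vr|.
Proof.
move=> [gL aL _]; rewrite -(size_map verts); apply: antichain_size aL.
by apply/allP => _ /mapP[e /gL[_ pe] ->].
Qed.

Lemma consistent1 : consistent [:: (induced G [fset vr], fset0)].
Proof.
have s1 : [fset vr] `<=` vertices G by rewrite fsub1set.
have e1 : verts (induced G [fset vr], fset0) = [fset vr].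
  by rewrite /verts vertices_induced_sub.
split.
- move=> e; rewrite inE => /eqP ->; rewrite e1; split=> //.
  by rewrite /pset s1 fset11.
- by split=> // U W; rewrite !inE => /eqP-> /eqP->.
- by move=> e; rewrite inE => /eqP ->.
Qed.

Lemma consistent_push L U : consistent L -> pset U ->
  {in L, forall f, ~~ pset (U `|` verts f)} ->
  consistent ((induced G U, fset0) :: L).
Proof.
move=> [gL aL vL] pU nL; have sU : U `<=` vertices G by case/and3P: pU.
have eU : verts (induced G U, fset0) = U by rewrite /verts vertices_induced_sub.
split.
- by move=> e; rewrite inE => /orP[/eqP->|/gL //]; rewrite eU.
- rewrite map_cons eU; apply/antichain_cons => //; split=> //.
  by move=> _ /mapP[f fL ->]; apply: nL.
- move=> e; rewrite inE => /orP[/eqP-> //|eL] v W vW sW pW.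
  exact/covers_cons/(vL _ eL _ _ vW sW pW).
Qed.

Lemma covers_replace e L U W : U `<=` vertices G -> verts e `<=` U ->
  covers (e :: L) W -> covers ((induced G U, fset0) :: L) W.
Proof.
move=> sU seU [f]; rewrite inE => /orP[/eqP-> sW|fL sW].
  exists (induced G U, fset0); first by rewrite inE eqxx.
  by rewrite /verts vertices_induced_sub // (fsubset_trans sW).
by exists f => //; rewrite inE fL orbT.
Qed.

Lemma consistent_replace e L U : consistent (e :: L) -> pset U ->
  verts e `<=` U -> consistent ((induced G U, fset0) :: L).
Proof.
move=> [gL aL vL] pU seU; have sU : U `<=` vertices G by case/and3P: pU.
have [_ pe] : e.1 = induced G (verts e) /\ pset (verts e).
  by apply: gL; rewrite inE eqxx.
have [aL' nL] := (antichain_cons (map verts L) pe).1 aL.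
have eU : verts (induced G U, fset0) = U by rewrite /verts vertices_induced_sub.
split.
- move=> f; rewrite inE => /orP[/eqP->|fL]; first by rewrite eU.
  by apply: gL; rewrite inE fL orbT.
- rewrite map_cons eU; apply/antichain_cons => //; split=> //.
  move=> _ /mapP[f fL ->].
  have [|_ pf] := gL f; first by rewrite inE fL orbT.
  (* An admissible union with the larger [U] would give one with [verts e]. *)
  have := nL _ (map_f _ fL); apply: contra.
  by rewrite fsetUC => /(pset_sub_union pf pe seU); rewrite fsetUC.
- move=> f; rewrite inE => /orP[/eqP-> //|fL] v W vW sW pW.
  apply: covers_replace sU seU _; apply: vL vW sW pW.
  by rewrite inE fL orbT.
Qed.

Lemma covers_mark e L (X : {fset T}) W :
  covers (e :: L) W -> covers ((e.1, X) :: L) W.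
Proof.
case=> f; rewrite inE => /orP[/eqP-> sW|fL sW].
  by exists (e.1, X); rewrite ?inE ?eqxx.
by exists f => //; rewrite inE fL orbT.
Qed.

Lemma consistent_mark e L v : consistent (e :: L) ->
  (forall W, W `<=` v |` verts e -> pset W -> covers (e :: L) W) ->
  consistent ((e.1, v |` e.2) :: L).
Proof.
move=> [gL aL vL] cv; split.
- move=> f; rewrite inE => /orP[/eqP->|fL].
    by apply: (gL e); rewrite inE eqxx.
  by apply: gL; rewrite inE fL orbT.
- exact: aL.
- move=> f; rewrite inE => /orP[/eqP->|fL] u W.
    move=> /fset1UP[->|ue] sW pW; apply: covers_mark; first exact: cv.
    by apply: vL ue sW pW; rewrite inE eqxx.
  move=> uf sW pW; apply: covers_mark; apply: vL uf sW pW.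
  by rewrite inE fL orbT.
Qed.

(** If [e] could grow, it would grow by a neighbour [v], which is in its Vbar. The third clause then
    puts [verts e] together with [v] into some entry [f], and the antichain forces [f] and [e] to
    have the same vertices, although [v] is not in [e]. *)
Lemma closed_maxset L e : consistent L -> e \in L ->
  neighbours k e.1 G `<=` e.2 -> maxset (vertices G) (verts e).
Proof.
move=> [gL [_ aL] vL] eL /fsubsetP cl; have [ee pe] := gL _ eL.
split=> //; first by case/and3P: pe.
move=> W sW pW seW; apply/eqP; rewrite eq_sym; apply/negPn/negP => neW.
have lt : verts e `<` W by rewrite fproperEneq neW.
have [v [vW ve pv [u ue auv]]] := pset_grow pW pe lt.
have ve2 : v \in e.2.
  apply: cl; rewrite in_neighbours (fsubsetP sW) //= ve /=.
  by apply/hasP; exists u.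
have [f fL /fsubsetP sf] := vL _ eL _ _ ve2 (fsubset_refl _) pv.
have [_ pf] := gL _ fL.
have sef : verts e `<=` verts f.
  by apply/fsubsetP => x xe; rewrite sf // fset1Ur.
have ef : verts e = verts f.
  by apply: aL; rewrite ?map_f // (fsetUidPr _ _ sef).
by case/negP: ve; rewrite ef sf // fset1U1.
Qed.

(* A maximal M is reached from {v_r} one vertex at a time: if C lies in
   M and in an entry H, and v in M \ H is adjacent to C, then v is in Vbar(H),
   so C + v lies in an entry as well. *)
Lemma closed_complete L (M : {fset T}) : consistent L -> L != [::] ->
  {in L, forall e, neighbours k e.1 G `<=` e.2} ->
  maxset (vertices G) M -> M \in map verts L.
Proof.
move=> cL nL clL [sM pM mM]; have [gL _ vL] := cL.
have vM : vr \in M by case/and3P: pM.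
have grow j : j < #|` M| ->
    exists C, [/\ C `<=` M, #|` C| = j.+1, pset C & covers L C].
  elim: j => [_|j IHj ltj].
    exists [fset vr]; split; rewrite ?fsub1set ?cardfs1 //.
      by rewrite /pset fsub1set vrG fset11.
    case: (L) nL gL => // e L' _ gL; exists e; first by rewrite inE eqxx.
    have [|_ /and3P[]] := gL e; first by rewrite inE eqxx.
    by rewrite fsub1set.
  have [C [sC cC pC [f fL sf]]] := IHj (ltnW ltj).
  have lt : C `<` M by rewrite fproperEcard sC cC.
  have [v [vM' vC pv [u uC auv]]] := pset_grow pM pC lt.
  exists (v |` C); split=> //.
  - by rewrite fsubUset fsub1set vM'.
  - by rewrite cardfsU1 vC cC.
  case vf: (v \in verts f).
    by exists f => //; rewrite fsubUset fsub1set vf.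
  apply: (vL _ fL v) => //; last exact: fsetUS.
  apply: (fsubsetP (clL _ fL)).
  rewrite in_neighbours (fsubsetP sM) //= -/(verts f) vf.
  by apply/hasP; exists u; rewrite // (fsubsetP sf).
have M0 : 0 < #|` M| by rewrite cardfs_gt0; apply/fset0Pn; exists vr.
(* At full size [C] is [M], so [M] lies in an entry and by maximality equals it. *)
have [|C [sC cC pC [f fL sf]]] := grow (#|` M|).-1; first by rewrite prednK.
have eC : C = M by apply/eqP; rewrite eqEfcard sC cC prednK // leqnn.
have [_ pf] := gL _ fL.
rewrite -(mM (verts f)) ?map_f -?eC //.
by case/and3P: pf.
Qed.

End Hereditary.

(** * Proof rules for computations with cost *)

Section Timed.
Variables A B : Type.

(** The invariant is indexed by the elements still to be processed. The cost depends on the element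
    because inserting a graph is charged by its size. *)
Lemma foreach_rule (I : seq A -> B -> Prop) (cost : A -> nat)
    (body : A -> B -> timed B) :
  (forall x l b b' t, I (x :: l) b -> body x b b' t -> I l b' /\ t <= cost x) ->
  forall l b b' t, I l b -> foreach l body b b' t ->
    I [::] b' /\ t <= \sum_(x <- l) cost x.
Proof.
move=> bodyP; elim=> [|x l IHl] b b' t Ib /=.
  by case=> -> ->; rewrite big_nil.
case=> b1 [t1 [t2 [bb1 bl ->]]]; have [I1 le1] := bodyP _ _ _ _ _ Ib bb1.
have [I2 le2] := IHl _ _ _ I1 bl.
by rewrite big_cons leq_add.
Qed.

Lemma foreach_total (body : A -> B -> timed B) :
  (forall x b, exists b' t, body x b b' t) ->
  forall l b, exists b' t, foreach l body b b' t.
Proof.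
move=> bodyT; elim=> [|x l IHl] b; first by exists b, 0.
have [b1 [t1 r1]] := bodyT x b; have [b2 [t2 r2]] := IHl b1.
by exists b2, (t1 + t2), b1, t1, t2.
Qed.

Lemma bind_total (m : timed A) (f : A -> timed B) :
  (exists x t, m x t) -> (forall x, exists y t, f x y t) ->
  exists y t, bind m f y t.
Proof.
move=> [x [t mx]] fT; have [y [t' fx]] := fT x.
by exists y, (t + t'), x, t, t'.
Qed.

(** The rising, bounded [mu] gives termination by induction on [bound - mu a]; it also dominates the
    number of iterations done, so [t0 + mu a * d] bounds the elapsed time. *)
Lemma while_ensures_measure (guard : pred A) (body : A -> timed A)
    (Q : A -> nat -> Prop) (I : A -> Prop) (mu : A -> nat) (bound d t0 : nat) :
  (forall a, I a -> mu a <= bound) ->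
  (forall a, I a -> guard a -> exists a' t, body a a' t) ->
  (forall a a' t, I a -> guard a -> body a a' t ->
     [/\ I a', mu a < mu a' & t <= d]) ->
  (forall a t, I a -> ~~ guard a -> t <= t0 + mu a * d -> Q a t) ->
  forall a t, I a -> t <= t0 + mu a * d -> while_ensures guard body Q a t.
Proof.
move=> muB bodyT bodyP exitP a.
have [m] := ubnP (bound - mu a); elim: m a => // m IHm a ltm t Ia let_.
case g: (guard a); last first.
  by apply: while_exit; rewrite ?g //; apply: exitP; rewrite ?g.
apply: while_loop => //; first exact: bodyT.
move=> a' t' /(bodyP _ _ _ Ia g)[Ia' lta let'].
have le' := muB _ Ia'; apply: IHm => //; first by lia.
by have : (mu a).+1 * d <= mu a' * d; [rewrite leq_mul2r lta orbT | lia].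
Qed.

End Timed.

(** * Stacks and the invariant of the inner loops *)

Section Runs.
Variables (T : choiceType) (c : nat) (k : kind) (P : graph_property T).
Variables (R : restricted_solver P) (G : graph T) (vr : T).
Variables (s : nat -> nat) (r' : nat -> nat -> nat).
Hypothesis herP : hereditary k P.
Hypothesis testP : test_time_bound P s.
Hypothesis solveR : solve_time_bound R r'.
Hypothesis vrG : vr \in vertices G.
Hypothesis Pvr : P (induced G [fset vr]).

Local Notation n := #|` vertices G|.
Local Notation K := #|` maximal_with P G vr|.
Local Notation pset := (pset P G vr).
Local Notation consistent := (consistent P G vr).
Implicit Types (st A : state T) (e h : entry T) (W : {fset T}).

Definition put e st : state T :=
  if neighbours k e.1 G `<=` e.2 then (st.1, e :: st.2) else (e :: st.1, st.2).

Lemma push_appropriateE e st st' t :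
  push_appropriate c k G e st st' t <-> st' = put e st /\ t = c * n.
Proof.
split=> [[_ [_ [_ [-> [-> ->] ->]]]]|[-> ->]]; first by rewrite addn0.
by exists tt, (c * n), 0; split; rewrite ?addn0.
Qed.

Definition entries st := st.1 ++ st.2.

Lemma put_perm e st : perm_eq (entries (put e st)) (e :: entries st).
Proof.
rewrite /put /entries; case: ifP => _ //=.
by rewrite perm_catC /= perm_cons perm_catC.
Qed.

Lemma size_put e st : size st.2 <= size (put e st).2.
Proof. by rewrite /put; case: ifP => //=. Qed.

(* The invariant of the inner loops, during which h is popped: only h
   can have a nonempty Vbar while its neighbours are not exhausted. *)
Definition sorted_stacks st :=
  {in st.1, forall e, e.2 = fset0 /\ ~~ (neighbours k e.1 G `<=` e.2)} /\
  {in st.2, forall e, neighbours k e.1 G `<=` e.2}.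

Definition inner_inv h st := consistent (h :: entries st) /\ sorted_stacks st.

(** Preserved coverage keeps earlier outputs of R' below some entry while later ones are merged; the
    size of Stack_2 is the leading term of [measure]. *)
Definition improves h st st' :=
  (forall W, covers (h :: entries st) W -> covers (h :: entries st') W) /\
  size st.2 <= size st'.2.

Lemma improves_trans h st1 st2 st3 :
  improves h st1 st2 -> improves h st2 st3 -> improves h st1 st3.
Proof.
move=> [c12 s12] [c23 s23]; split; last exact: leq_trans s23.
by move=> W /c12/c23.
Qed.

Lemma sorted_put H st : sorted_stacks st -> sorted_stacks (put (H, fset0) st).
Proof.
move=> [s1 s2]; rewrite /put; case: ifP => /= cl; split=> //= e;
  rewrite inE => /orP[/eqP->|] //=; [exact: s2|by rewrite cl|exact: s1].
Qed.

Lemma perm_cons2 e h (L : seq (entry T)) : perm_eq (e :: h :: L) (h :: e :: L).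
Proof. exact/permPl/(perm_catCA [:: e] [:: h] L). Qed.

Lemma cons_put_perm h e st :
  perm_eq (e :: h :: entries st) (h :: entries (put e st)).
Proof.
by apply: perm_trans (perm_cons2 _ _ _) _; rewrite perm_cons perm_sym put_perm.
Qed.

Lemma inner_inv_put h H st :
  consistent ((H, fset0) :: h :: entries st) -> sorted_stacks st ->
  inner_inv h (put (H, fset0) st).
Proof.
move=> cs ss; split; last exact: sorted_put.
exact: consistent_perm (cons_put_perm _ _ _) cs.
Qed.

Lemma covers_put h H st W :
  covers ((H, fset0) :: h :: entries st) W ->
  covers (h :: entries (put (H, fset0) st)) W.
Proof. exact: covers_perm (cons_put_perm _ _ _). Qed.

Lemma inner_size h st : inner_inv h st ->
  size st.1 <= K /\ size st.2 <= K.
Proof.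
case=> /(consistent_size herP Pvr); rewrite /= size_cat => le _; lia.
Qed.

Lemma prop_time_induced W : prop_time P (induced G W) <= s n.
Proof. by apply: testP; apply: fsubset_leq_card; apply: fsubsetIl. Qed.

(** * Insertion of one graph returned by R' *)

Section Insert.
Variables (h : entry T) (G' : graph T).
Hypothesis eG' : G' = induced G (vertices G').
Hypothesis pG' : pset (vertices G').
Hypothesis hG' : ~~ pset (vertices G' `|` verts h).

(** Here [l] holds the entries not yet visited. If the flag is still false once [l] is empty, no
    entry of Stack_1 has an admissible union with [G']. *)
Definition absorb_inv st (l : seq (entry T)) (x : state T * bool) :=
  [/\ inner_inv h x.1, improves h st x.1, uniq l, {subset l <= x.1.1} &
    if x.2 then covers (h :: entries x.1) (vertices G')
    else {in x.1.1, forall e, e \in l \/ ~~ pset (vertices G' `|` verts e)}].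

Lemma absorb_step st e l x x' t :
  absorb_inv st (e :: l) x -> absorb c k P G G' e x x' t ->
  absorb_inv st l x' /\ t <= 2 * (c * n) + s n.
Proof.
case=> -[cx sx] ix /= /andP[el ul] slx fx.
have ex : e \in x.1.1 by apply: slx; rewrite inE eqxx.
have slx' : {subset l <= x.1.1} by move=> f fl; apply: slx; rewrite inE fl orbT.
have pt := prop_time_induced (vertices G' `|` vertices e.1).
case=> _ [_ [t2 [-> + ->]]].
have sG' : vertices G' `<=` vertices G by case/and3P: pG'.
have [gx _ _] := cx.
have [_ pe] : e.1 = induced G (verts e) /\ pset (verts e).
  by apply: gx; rewrite inE mem_cat ex orbT.
have se : verts e `<=` vertices G by case/and3P: pe.
have vG' : vr \in vertices G' by case/and3P: pG'.
rewrite {1}/join; case: ifP => PG.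
- case=> st1 [t3 [_ [/push_appropriateE[-> ->] [-> ->] ->]]].
  split; last by rewrite /join; lia.
  set U := vertices G' `|` vertices e.1; rewrite /join -/U.
  have pU : pset U by rewrite /pset PG in_fsetU vG' fsubUset sG' se.
  have sU : U `<=` vertices G by case/and3P: pU.
  have seU : verts e `<=` U := fsubsetUr _ _.
  set A := (rem e x.1.1, x.1.2).
  have pe1 : perm_eq (h :: entries x.1) (e :: h :: entries A).
    apply: perm_trans (perm_cons2 h e (entries A)); rewrite perm_cons.
    by rewrite -cat_cons perm_cat2r perm_to_rem.
  have sub_rem f : f \in x.1.1 -> f != e -> f \in rem e x.1.1.
    by rewrite (perm_mem (perm_to_rem ex)) inE => /orP[->|].
  have cov W : covers (h :: entries x.1) W ->
      covers (h :: entries (put (induced G U, fset0) A)) W.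
    move=> cW; apply: covers_put; apply: covers_replace sU seU _.
    exact: covers_perm pe1 cW.
  have iA : inner_inv h (put (induced G U, fset0) A).
    apply: inner_inv_put.
      have cA := consistent_perm pe1 cx.
      exact: (consistent_replace herP Pvr cA pU seU).
    case: sx => s1 s2; split=> //= f /mem_rem; exact: s1.
  split=> //=.
  + apply: improves_trans ix _; split=> //.
    exact: leq_trans (size_put _ A).
  (* As [e] is not in [l], its removal keeps every unvisited entry on Stack_1. *)
  + move=> f fl; have : f \in rem e x.1.1.
      by apply: sub_rem; [apply: slx' | apply: contraNneq el => <-].
    by rewrite /put; case: ifP => _ //= fr; rewrite inE fr orbT.
  + apply: covers_put; exists (induced G U, fset0); first by rewrite inE eqxx.
    by rewrite /verts vertices_induced_sub // fsubsetUl.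
- case=> -> ->; split; last by rewrite /join; lia.
  split=> //; case: (x.2) fx => // fx f fx1.
  have [|] := fx f fx1; last by right.
  rewrite inE => /orP[/eqP->|]; last by left.
  by right; apply/negP => /and3P[_ _]; rewrite PG.
Qed.

Lemma insert_run st st' t : inner_inv h st -> insert c k P G G' st st' t ->
  [/\ inner_inv h st', improves h st st',
    covers (h :: entries st') (vertices G') &
    t <= c * n * #|` vertices G'| + (K * (3 * (c * n) + s n) + c * n)].
Proof.
move=> ist [_ [_ [t3 [-> + ->]]]].
case=> l [_ [t4 [[pl ->] + ->]]]; case=> x [t1 [t5 [run + ->]]].
case=> _ [_ [t2 [-> fin ->]]].
have us : uniq st.1.
  case: ist => -[_ [+ _] _] _.
  by rewrite /= map_cat cat_uniq => /andP[_ /andP[/map_uniq]].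
have a0 : absorb_inv st l (st, false).
  split=> //=.
  - by rewrite -(perm_uniq pl).
  - by move=> f; rewrite (perm_mem pl).
  - by move=> f fs; left; rewrite -(perm_mem pl).
have [[ix imx _ _ fx] let1] := foreach_rule (@absorb_step st) a0 run.
have [ss1 _] := inner_size ist; have [_ sx2] := inner_size ix.
have t1K : t1 <= K * (2 * (c * n) + s n).
  apply: leq_trans let1 _.
  by rewrite big_const_seq count_predT iter_addn_0 -(perm_size pl) mulnC
     leq_mul2r ss1 orbT.
have x2K : c * n * size x.1.2 <= c * n * K by rewrite leq_mul2l sx2 orbT.
(* The third [c * n] per entry pays for the scan of Stack_2. *)
have -> : K * (3 * (c * n) + s n) = K * (2 * (c * n) + s n) + c * n * K by lia.
move: fin; case: ifP => [found|].
  case=> -> ->; split=> //; last by lia.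
  case/orP: found => [x2|/hasP[f f2 sf]]; first by rewrite x2 in fx.
  by exists f => //; rewrite inE mem_cat f2 !orbT.
move/negbT; rewrite negb_or => /andP[/negbTE x2 /hasPn nS2].
rewrite x2 in fx; move=> /push_appropriateE[-> ->].
have [cx sx] := ix; have [gx _ _] := cx.
have sG' : vertices G' `<=` vertices G by case/and3P: pG'.
(* No entry has an admissible union with [G']: for [h] by hypothesis, for Stack_1 by the flag.
   Entries of Stack_2 are maximal, so an admissible union would put [G'] inside one, which the
   inclusion test has excluded. *)
have cp : consistent ((G', fset0) :: h :: entries x.1).
  rewrite {1}eG'; apply: consistent_push => // f.
  rewrite inE mem_cat => /or3P[/eqP-> //|f1|f2].
    by have [|//] := fx f f1; rewrite in_nil.
  have fE : f \in h :: entries x.1 by rewrite inE mem_cat f2 !orbT.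
  have [_ _ mf] := closed_maxset herP Pvr cx fE (sx.2 _ f2).
  apply: contra (nS2 _ f2) => pf.
  rewrite -/(verts f) -(mf _ _ pf (fsubsetUr _ _)) ?fsubsetUl //.
  by case/and3P: pf.
have cov W : covers (h :: entries x.1) W ->
    covers (h :: entries (put (G', fset0) x.1)) W.
  by move=> cW; apply: covers_put; apply: covers_cons.
split.
- exact: inner_inv_put.
- by apply: improves_trans imx _; split=> //; apply: size_put.
- apply: covers_put; exists (G', fset0); first by rewrite inE eqxx.
  exact: fsubset_refl.
- lia.
Qed.

End Insert.

(** * Invariant and progress of the main loop *)

Definition outer_inv st :=
  if st.1 is h :: stack1 then
    [/\ inner_inv h (stack1, st.2), h.2 `<=` neighbours k h.1 G &
        ~~ (neighbours k h.1 G `<=` h.2)]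
  else [/\ consistent st.2, st.2 != [::] &
           {in st.2, forall e, neighbours k e.1 G `<=` e.2}].

(* The top of Stack_1 stays there until its neighbours are exhausted; until
   then each iteration gives it a vertex or enlarges its Vbar. *)
Definition measure st :=
  size st.2 * n ^ 2 +
  (if st.1 is h :: _ then (#|` verts h| - 1) * n + #|` h.2| else 0).

(** If [h] moves to Stack_2, the next top of Stack_1 has an empty Vbar and unexhausted neighbours,
    so it can take the role of [h]. *)
Lemma outer_put h st : inner_inv h st -> h.2 `<=` neighbours k h.1 G ->
  outer_inv (put h st).
Proof.
case: st => S1 S2 [cs [/= s1 s2]] sh.
rewrite /put /=; case: ifP => cl; last by split=> //; rewrite cl.
have sc : {in h :: S2, forall e, neighbours k e.1 G `<=` e.2}.
  by move=> e; rewrite inE => /orP[/eqP-> //|]; apply: s2.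
case: S1 cs s1 => [|e S1] cs s1; first by split.
have [e0 ne] : e.2 = fset0 /\ ~~ (neighbours k e.1 G `<=` e.2).
  by apply: s1; rewrite inE eqxx.
split; [|by rewrite e0 fsub0set|by []].
split; last by split=> // f fS; apply: s1; rewrite inE fS orbT.
apply: consistent_perm cs; apply: perm_trans (perm_cons2 _ _ _) _.
rewrite perm_cons /entries /= -cat_cons perm_sym.
by rewrite perm_catC /= perm_cons perm_catC.
Qed.

Lemma head_card h : pset (verts h) -> h.2 `<=` neighbours k h.1 G ->
  0 < #|` verts h| /\ #|` verts h| + #|` h.2| <= n.
Proof.
case/and3P=> sh vh _ sh2; split.
  by rewrite cardfs_gt0; apply/fset0Pn; exists vr.
have : h.2 `<=` vertices G `\` verts h.
  apply: fsubset_trans sh2 _; apply/fsubsetP => v.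
  by rewrite in_neighbours in_fsetD => /and3P[-> -> _].
move/fsubset_leq_card; rewrite cardfsDS // => le.
by rewrite -(subnKC (fsubset_leq_card sh)) leq_add2l.
Qed.

Lemma phase_length h : pset (verts h) -> h.2 `<=` neighbours k h.1 G ->
  (#|` verts h| - 1) * n + #|` h.2| <= n ^ 2.
Proof.
move=> ph sh; have [h0 hn] := head_card ph sh.
have : (#|` verts h| - 1) * n <= (n - 1) * n by rewrite leq_mul2r; lia.
rewrite mulnBl mul1n -mulnn; have : n <= n * n by apply: leq_pmulr; lia.
lia.
Qed.

(** When [h] goes to Stack_2 its contribution disappears, but by [phase_length] the extra [n ^ 2]
    makes up for it. *)
Lemma measure_put h st : pset (verts h) -> h.2 `<=` neighbours k h.1 G ->
  size st.2 * n ^ 2 + ((#|` verts h| - 1) * n + #|` h.2|) <= measure (put h st).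
Proof.
move=> ph sh; have le := phase_length ph sh.
rewrite /measure /put; case: ifP => _ //=.
by rewrite mulSn (addnC (n ^ 2)) -addnA leq_add2l (leq_trans le) ?leq_addr.
Qed.

Lemma measure_bound st : outer_inv st -> measure st <= K * n ^ 2.
Proof.
case: st => [[|h S1] S2] /=; rewrite /measure /=.
  case=> /(consistent_size herP Pvr) le _ _.
  by rewrite addn0 leq_mul2r le orbT.
case=> -[cs ss] sh _; have [gs _ _] := cs.
have [|_ ph] := gs h; first by rewrite inE eqxx.
have := consistent_size herP Pvr cs; rewrite /= size_cat => le.
(* The top of Stack_1 is one more entry besides Stack_2, so [(size S2).+1] is at most [K]. *)
apply: (@leq_trans ((size S2).+1 * n ^ 2)); last first.
  by rewrite leq_mul2r (leq_trans _ le) ?orbT // ltnS leq_addl.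
by rewrite mulSn addnC leq_add2r phase_length.
Qed.

(** * No run gets stuck *)

Lemma push_total e st : exists st' t, push_appropriate c k G e st st' t.
Proof. by exists (put e st), (c * n); apply/push_appropriateE. Qed.

Lemma tick_total d : exists x t, tick d x t.
Proof. by exists tt, d. Qed.

Lemma ret_total X (x : X) : exists y t, ret x y t.
Proof. by exists x, 0. Qed.

Lemma absorb_total (H : graph T) e x : exists x' t, absorb c k P G H e x x' t.
Proof.
apply: bind_total (tick_total _) _ => _; case: ifP => _; last exact: ret_total.
by apply: bind_total (push_total _ _) _ => st; apply: ret_total.
Qed.

Lemma insert_total (H : graph T) st : exists st' t, insert c k P G H st st' t.
Proof.
apply: bind_total (tick_total _) _ => _.
apply: bind_total => [|l]; first by exists st.1, 0.
apply: bind_total => [|x]; first by apply: foreach_total; apply: absorb_total.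
apply: bind_total (tick_total _) _ => _.
by case: ifP => _; [apply: ret_total | apply: push_total].
Qed.

Lemma iteration_total st : outer_inv st -> ~~ nilp st.1 ->
  exists st' t, iteration c k R G vr st st' t.
Proof.
case: st => [[|[H Vbar] S1] S2] //= [_ _ /fsubsetPn[v vN vV]] _.
apply: bind_total (tick_total _) _ => _.
apply: bind_total => [|w]; first by exists v, 0; rewrite /pick_in /= in_fsetD vV.
apply: bind_total (tick_total _) _ => _;
case: ifP => _; first exact: push_total.
do 2 apply: bind_total (tick_total _) _ => _.
apply: bind_total => [|st']; last exact: push_total.
by apply: foreach_total; apply: insert_total.
Qed.

(** * Adding a vertex to Vbar after a call to R' *)

Section Mark.
Variables (h : entry T) (v : T).
Hypothesis eh : h.1 = induced G (verts h).
Hypothesis ph : pset (verts h).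
Hypothesis vN : v \in neighbours k h.1 G.
Hypothesis nPv : ~~ P (add_vertex G h.1 v).

Let D := v |` verts h.
Let out := R (induced G D) vr.

Lemma mark_sub : D `<=` vertices G.
Proof.
case/and3P: ph => sh _ _; rewrite fsubUset sh andbT fsub1set.
by move: vN; rewrite in_neighbours => /and3P[].
Qed.

Lemma mark_almost :
  almost_satisfies P (induced G D) /\ vr \in vertices (induced G D).
Proof.
case/and3P: ph => sh vh Ph; rewrite vertices_induced_sub ?mark_sub //.
split; last by rewrite in_fset1U vh orbT.
exists v; rewrite /del_vertex vertices_induced_sub ?mark_sub ?fset1U1 //.
rewrite induced_induced ?fsubD1set // fsetU1K //.
by move: vN; rewrite in_neighbours => /and3P[].
Qed.
Lemma mem_mark H : (H \in out) = (H \in maximal_with P (induced G D) vr).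
Proof. by have [am vD] := mark_almost; rewrite (perm_mem (solveP R am vD)). Qed.

Lemma mark_outP H : H \in out ->
  H = induced G (vertices H) /\ maxset P G vr D (vertices H).
Proof. by rewrite mem_mark; apply/maximal_withP/mark_sub. Qed.

(** The graphs returned for G[H, v] are maximal only there, but they form an antichain of admissible
    sets of [G], so they extend to distinct maximal graphs of [G]. This justifies the second
    argument of [r' n K]. *)
Lemma mark_size : size out <= K.
Proof.
have [am vD] := mark_almost.
have uo : uniq out by rewrite (perm_uniq (solveP R am vD)) fset_uniq.
rewrite -(size_map (@vertices T)); apply: (antichain_size herP Pvr).
  by apply/allP => _ /mapP[H /mark_outP[_ [_ pH _]] ->].
apply: (@maxset_antichain _ _ _ _ D).
  rewrite map_inj_in_uniq // => H1 H2 /mark_outP[e1 _] /mark_outP[e2 _] e12.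
  by rewrite e1 e2 e12.
by move=> _ /mapP[H /mark_outP[_ mH] ->].
Qed.

Lemma mark_time : solve_time R (induced G D) vr <= r' n K.
Proof.
have [am vD] := mark_almost; have [_] := solveR n K; apply=> //.
  by apply: fsubset_leq_card; apply: fsubsetIl.
exact: mark_size.
Qed.

(** By maximality [H] contains [v], as otherwise it would lie in [h] and equal it. The union is then
    all of [D], which fails [P]. *)
Lemma mark_fresh H : H \in out -> H != h.1 ->
  ~~ pset (vertices H `|` verts h).
Proof.
move=> /mark_outP[eH [sH pH mH]] nH; apply/negP => pHh.
have shD : verts h `<=` D := fsubsetU1 _ _.
have vH : v \in vertices H.
  apply: contraNT nH => vH; rewrite eH eh; apply/eqP; congr induced.
  apply/esym/mH => //; apply/fsubsetP => x xH.
  move: (fsubsetP sH _ xH); rewrite in_fset1U => /orP[/eqP xv|//].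
  by rewrite -xv xH in vH.
case/negP: nPv; case/and3P: pHh => _ _; congr (P (induced G _)).
apply/eqP; rewrite eqEfsubset fsubUset sH shD /= fsubUset fsub1set.
by rewrite in_fsetU vH fsubsetUr.
Qed.

Let todo := [seq H <- out | H != h.1].

Definition insert_cost (H : graph T) :=
  c * n * #|` vertices H| + (K * (3 * (c * n) + s n) + c * n).

Lemma mark_loop st st' t : inner_inv h st ->
  foreach todo (insert c k P G) st st' t ->
  [/\ inner_inv h st', size st.2 <= size st'.2,
      forall W, W `<=` D -> pset W -> covers (h :: entries st') W &
      t <= \sum_(H <- todo) insert_cost H].
Proof.
move=> ist run.
pose I (l : seq (graph T)) st1 := [/\ inner_inv h st1, size st.2 <= size st1.2,
  {subset l <= todo} &
  {in todo, forall H, H \in l \/ covers (h :: entries st1) (vertices H)}].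
have Istep (H : graph T) l st1 st2 t1 :
    I (H :: l) st1 -> insert c k P G H st1 st2 t1 ->
    I l st2 /\ t1 <= insert_cost H.
  case=> i1 s1 sl cov ins.
  have : H \in todo by apply: sl; rewrite inE eqxx.
  rewrite mem_filter => /andP[nH Ho]; have [eH [sH pH mH]] := mark_outP Ho.
  have [i2 [c12 s12] cH let1] := insert_run eH pH (mark_fresh Ho nH) i1 ins.
  split=> //; split=> //; first exact: leq_trans s12.
    by move=> X Xl; apply: sl; rewrite inE Xl orbT.
  move=> X /cov[|cX]; last by right; apply: c12.
  by rewrite inE => /orP[/eqP->|]; [right | left].
have [|[i' s' _ cov] let_] := foreach_rule Istep _ run.
  by split=> // H; left.
(* A maximal extension of [W] inside [D] is either [h] itself or one of the graphs just inserted. *)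
split=> // W sW pW; have [M mM sWM] := maxset_extend sW pW.
apply: covers_sub sWM _; have [sM pM _] := mM.
have [eM|nM] := eqVneq (verts h) M.
  by exists h; rewrite ?inE ?eqxx // eM.
have sMG := fsubset_trans sM mark_sub.
have MV : vertices (induced G M) = M by rewrite vertices_induced_sub.
have := cov (induced G M); rewrite MV mem_filter mem_mark.
case=> //; apply/andP; split.
  by apply: contraNneq nM => eM; rewrite /verts -eM MV.
by apply/maximal_withP; rewrite ?mark_sub ?MV.
Qed.

(** R' has to write its output, so the total number of vertices returned is at most its running
    time. *)
Lemma sum_insert_cost :
  \sum_(H <- todo) insert_cost H <=
  c * n * r' n K + size out * (K * (3 * (c * n) + s n) + c * n).
Proof.
have [am vD] := mark_almost.
rewrite /insert_cost big_split /= leq_add //.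
  rewrite -big_distrr /= leq_mul2l (leq_trans _ mark_time) ?orbT //.
  apply: leq_trans (solve_output R am vD).
  by rewrite big_filter big_mkcond leq_sum // => H _; case: ifP.
by rewrite big_const_seq count_predT iter_addn_0 mulnC leq_mul2r
  size_filter count_size orbT.
Qed.

(** Each returned graph contains [vr], so writing it down takes at least one step. *)
Lemma size_mark_time : size out <= r' n K.
Proof.
have [am vD] := mark_almost; apply: leq_trans mark_time.
apply: leq_trans (solve_output R am vD).
rewrite -sum1_size big_seq [leqRHS]big_seq leq_sum // => H.
move=> /mark_outP[_ [_ pH _]].
by case/and3P: pH => _ vH _; rewrite cardfs_gt0; apply/fset0Pn; exists vr.
Qed.

End Mark.

(** * Total cost and correctness of a run *)

Lemma leq_pscale (m p x y : nat) : 0 < m -> 0 < p -> x <= y -> x <= m * p * y.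
Proof.
by move=> m0 p0 le; rewrite -[x]mul1n leq_mul // muln_gt0 m0.
Qed.

(** Here [o] is the number of graphs returned by R'. After expansion there are eight terms with
    factor [c] and three without ([S], [r] and [o * K' * S]), each at most [K' * r * (S + N)] up to
    [c]. *)
Lemma charges_bound (N S K' r o : nat) :
  0 < N -> 0 < K' -> 0 < r -> o <= r ->
  c * N + (S + (r + (c * N * o +
    (c * N * r + o * (K' * (3 * (c * N) + S) + c * N) + c * N)))) <=
  (8 * c + 3) * (K' * r * (S + N)).
Proof.
move=> N0 K0 r0 le; set A := K' * r * (S + N).
have NA : N <= A by apply: leq_pscale; rewrite ?leq_addl.
have SA : S <= A by apply: leq_pscale; rewrite ?leq_addr.
have rNA : r * N <= A by rewrite /A leq_mul ?leq_addl // leq_pmull.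
have rA : r <= A by apply: leq_trans rNA; rewrite leq_pmulr.
have oNA : o * N <= A by apply: leq_trans rNA; rewrite leq_mul2r le orbT.
have oKNA : K' * o * N <= A.
  by rewrite /A leq_mul ?leq_addl // leq_mul2l le orbT.
have oKSA : K' * o * S <= A.
  by rewrite /A leq_mul ?leq_addr // leq_mul2l le orbT.
have cA x : x <= A -> c * x <= c * A by move=> lx; rewrite leq_mul2l lx orbT.
have := cA _ NA; have := cA _ rNA; have := cA _ oNA; have := cA _ oKNA.
move: SA rA oKSA; clear; lia.
Qed.

Lemma iteration_run st st' t : outer_inv st -> ~~ nilp st.1 ->
  iteration c k R G vr st st' t ->
  [/\ outer_inv st', measure st < measure st' &
      t <= (8 * c + 3) * (K * r' n K * (s n + n))].
Proof.
case: st => [[|[H Vbar] S1] S2] // ost _; pose h : entry T := (H, Vbar).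
have [ist sh nh] : [/\ inner_inv h (S1, S2), h.2 `<=` neighbours k h.1 G &
    ~~ (neighbours k h.1 G `<=` h.2)] by [].
have [cs ss] := ist; have [gs _ _] := cs.
have [|eh ph] := gs h; first by rewrite inE eqxx.
have [h0 hn] := head_card ph sh.
have K1 : 0 < K by apply: leq_trans (consistent_size herP Pvr cs).
have [r1 _] := solveR n K.
have n1 : 0 < n by lia.
rewrite /iteration.
case=> _ [_ [t1 [-> + ->]]]; case=> v [_ [t2 [[vN ->] + ->]]].
case=> _ [_ [t3 [-> + ->]]].
have [vNh vV] : v \in neighbours k h.1 G /\ v \notin h.2.
  by move: vN; rewrite /= in_fsetD => /andP[].
have [vG vh] : v \in vertices G /\ v \notin verts h.
  by move: vNh; rewrite in_neighbours => /and3P[].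
have pt := prop_time_induced (v |` vertices H).
case: ifP => PHv.
- case/push_appropriateE => -> ->.
  set U := v |` verts h.
  have pU : pset U.
    case/and3P: ph => sh' vh' _; rewrite /pset PHv
      in_fset1U vh' orbT.
    by rewrite fsubUset fsub1set vG sh'.
  have sU : U `<=` vertices G by case/and3P: pU.
  have cU := consistent_replace herP Pvr cs pU (fsubsetU1 _ _).
  have pU' : pset (verts (induced G U, fset0)).
    by rewrite /verts vertices_induced_sub.
  split.
  + by apply: outer_put; rewrite ?fsub0set.
  + apply: leq_trans (measure_put _ pU' (fsub0set _)).
    rewrite /verts /= vertices_induced_sub // cardfsU1 vh /measure /= -/h.
    rewrite -addnS leq_add2l addKn addn0.
    (* The new vertex gains [n], more than the size of the Vbar that is reset. *)
    rewrite -[in leqRHS](subnK h0) mulnDl mul1n -addnS leq_add2l.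
    by apply: leq_trans hn; rewrite -[X in X <= _]add1n leq_add2r.
  (* Without a call to R' the bound is used with [o] equal to 0. *)
  + apply: leq_trans (charges_bound (s n) n1 K1 r1 (leq0n _)).
    move: pt; rewrite /add_vertex; clear; lia.
- case=> _ [_ [t4 [-> + ->]]]; case=> _ [_ [t5 [-> + ->]]].
  case=> st1 [t6 [t7 [run /push_appropriateE[-> ->] ->]]].
  have nPv : ~~ P (add_vertex G h.1 v) by rewrite PHv.
  have [i1 s1 cov let6] := mark_loop eh ph vNh nPv ist run.
  have t6' := leq_trans let6 (sum_insert_cost ph vNh).
  have sz := mark_size ph vNh; have szt := size_mark_time ph vNh.
  have st0 := mark_time ph vNh.
  have sV' : (H, v |` Vbar).2 `<=` neighbours k (H, v |` Vbar).1 G.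
    by rewrite fsubUset fsub1set vNh sh.
  have cm := consistent_mark i1.1 cov.
  split.
  + have ih : inner_inv (H, v |` Vbar) st1 := conj cm i1.2.
    exact: (@outer_put (H, v |` Vbar) st1 ih sV').
  + apply: leq_trans (measure_put (h := (H, v |` Vbar)) _ ph sV').
    rewrite /measure /= cardfsU1 vV -addnS -addnS /= add1n leq_add2r.
    by rewrite leq_mul2r s1 orbT.
  + apply: leq_trans (charges_bound (s n) n1 K1 r1 szt).
    rewrite add0n leq_add2l; apply: leq_add pt _; apply: leq_add st0 _.
    by rewrite leq_add2l leq_add2r; exact: t6'.
Qed.

Lemma gen_with_vertex_run :
  gen_with_vertex_ensures c k R G vr (fun out t =>
    out =i maximal_with P G vr /\
    t <= (9 * c + 3) * (n ^ 2 * K ^ 2 * r' n K * (s n + n))).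
Proof.
move=> st t /push_appropriateE[-> ->].
set e1 := (induced G [fset vr], fset0).
pose d := (8 * c + 3) * (K * r' n K * (s n + n)).
apply: (@while_ensures_measure _ _ _ _ outer_inv measure (K * n ^ 2) d (c * n)).
- exact: measure_bound.
- exact: iteration_total.
- exact: iteration_run.
- case=> [[|h S1] S2] t' // ost _ let'; have [cs nS cl] := ost.
  split=> [H|].
    rewrite -[G in maximal_with _ G]induced_vertices.
    have sG := fsubset_refl (vertices G).
    apply/mapP/(maximal_withP _ _ _ sG) => [[e eS ->]|[eH mH]].
      have [gs _ _] := cs; have [ee _] := gs _ eS.
      by split=> //; apply: (closed_maxset herP Pvr cs eS (cl _ eS)).
    have /mapP[e eS eV] := closed_complete herP vrG Pvr cs nS cl mH.
    have [gs _ _] := cs; have [ee _] := gs _ eS.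
    by exists e => //; rewrite eH ee eV.
  have K1 : 0 < K.
    by apply: leq_trans (consistent_size herP Pvr cs); case: (S2) nS.
  have [r1 _] := solveR n K.
  have n1 : 0 < n by rewrite cardfs_gt0; apply/fset0Pn; exists vr.
  apply: leq_trans let' _.
  (* The iterations cost at most [(8 * c + 3) * B], and the initial push [c * n] is at most [c * B],
     whence [9 * c + 3]. *)
  set B := n ^ 2 * K ^ 2 * r' n K * (s n + n).
  have nB : n <= B.
    rewrite /B; apply: leq_pscale => //; last exact: leq_addl.
    by rewrite muln_gt0 !expn_gt0 n1 K1.
  have mB : measure ([::], S2) * d <= (8 * c + 3) * B.
    apply: leq_trans (_ : K * n ^ 2 * d <= _).
      by rewrite leq_mul2r measure_bound ?orbT.
    by rewrite /d /B; apply/eq_leq; rewrite -!mulnn; clear; lia.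
  have := leq_mul (leqnn c) nB; move: mB; clear; lia.
- apply: outer_put; last exact: fsub0set.
  by split; [apply: consistent1 | split].
- exact: leq_addr.
Qed.

End Runs.


Theorem theorem6p1 (c : nat) :
  exists C : nat,
  forall (T : choiceType) (k : kind) (P : graph_property T)
    (R : restricted_solver P) (s : nat -> nat) (r' : nat -> nat -> nat)
    (G : graph T) (vr : T),
    hereditary k P ->
    test_time_bound P s ->
    solve_time_bound R r' ->
    vr \in vertices G ->
    P (induced G [fset vr]) ->
    let n := #|` vertices G| in
    let K := #|` maximal_with P G vr| in
    gen_with_vertex_ensures c k R G vr
      (fun out t =>
         out =i maximal_with P G vr /\
         t <= C * (n ^ 2 * K ^ 2 * r' n K * (s n + n))).
Proof.
exists (9 * c + 3) => T k P R s r' G vr herP testP solveR vrG Pvr n K.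
exact: gen_with_vertex_run.
Qed.
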